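(* Let $c>0$. The process $\{G_n^{(c)}\}_{n\ge1}$ defined by $$G_n^{(c)}=\sqrt{\frac{c^2}{n+c^2}}\left(\frac{(n+c^2)V_n}{(n+c^2)V_n-S_n^2}\right)^{n/2}$$ is a nonnegative martingale for $\mathcal N_{\mu=0}=\{N(0,\sigma^2):\sigma>0\}$ on the scale invariant filtration $\{\mathcal F_n^*\}_{n\ge1}$, with expected value $\mathbb E[G_n^{(c)}]=G_1^{(c)}=1$. Consequently, for $\alpha\in(0,1)$, let $$\mathrm{radius}_n=\sqrt{\frac{(n+c^2)\left(1-\left(\frac{\alpha^2c^2}{n+c^2}\right)^{1/n}\right)}{\left\{\left(\frac{\alpha^2c^2}{n+c^2}\right)^{1/n}(n+c^2)-c^2\right\}\vee0}\left(\overline{X_n^2}-\widehat\mu_n^2\right)},$$ with $\mathrm{radius}_n=\infty$ when the denominator is $0$. Then the intervals $[\widehat\mu_n\pm\mathrm{radius}_n]$, $n\ge1$ (equal to $\mathbb R$ when $\mathrm{radius}_n=\infty$), form a $(1-\alpha)$-confidence sequence for $\mu$ over $\mathcal N$: for every $\mu\in\mathbb R$, $\sigma>0$, if $X_1,X_2,\dots$ are i.i.d. $N(\mu,\sigma^2)$, then $\Pr[\forall n\ge1,\ |\widehat\mu_n-\mu|\le\mathrm{radius}_n]\ge1-\alpha$.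
   Context: $S_n=\sum_{i=1}^nX_i$, $V_n=\sum_{i=1}^nX_i^2$, $\widehat\mu_n=S_n/n$, $\overline{X_n^2}=V_n/n$, $a\vee b=\max(a,b)$; $\mathcal N=\{N(\mu,\sigma^2):\mu\in\mathbb R,\sigma>0\}$ is the set of nondegenerate normal laws. A measurable $f:\mathbb R^n\to\mathbb R$ is scale invariant if $f(\lambda x_1,\dots,\lambda x_n)=f(x_1,\dots,x_n)$ for all $x\in\mathbb R^n$, $\lambda>0$; $\mathcal F_n^*=\sigma(f(X_1,\dots,X_n):f\text{ scale invariant})$. $\{M_n\}$ is a nonnegative martingale for a class $\mathcal P$ on $\{\mathcal G_n\}$ if, for every $P\in\mathcal P$, when $X_1,X_2,\dots$ are i.i.d. from $P$, it is a nonnegative $\{\mathcal G_n\}$-martingale. The null event $\{V_n=0\}$ may be treated arbitrarily. *)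

(* Defs.v *)
From HB Require Import structures.
From mathcomp Require Export all_boot all_order all_algebra finmap.
From mathcomp Require Export all_classical all_reals all_analysis.

Set Implicit Arguments.
Unset Strict Implicit.
Unset Printing Implicit Defensive.

Import Order.TTheory GRing.Theory Num.Theory.
Import numFieldNormedType.Exports.

Local Open Scope classical_set_scope.
Local Open Scope ring_scope.

(* The sequence X_1, X_2, ... is stored from index 0: the term X i is X_{i+1},
   and the first n observations are the X i with i < n.  Processes and
   filtrations are functions on nat of which only the indices n >= 1 matter. *)

Section iid.
Context {d : measure_display} {T : measurableType d} {R : realType}.
Variables (P : probability T R) (X : nat -> {RV P >-> R}).

Definition mutually_independent : Prop :=
  forall (J : {fset nat}) (B : nat -> set R), (forall i, measurable (B i)) ->
    P (\bigcap_(i in [set` J]) (X i @^-1` B i)) =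
    (\prod_(i <- J) P (X i @^-1` B i))%E.

Definition iid_from (Q : set R -> \bar R) : Prop :=
  mutually_independent /\
  forall i (B : set R), measurable B -> distribution P (X i) B = Q B.

End iid.

Section martingale.
Context {d : measure_display} {T : measurableType d} {R : realType}.
Variable P : probability T R.

Definition filtration (F : nat -> set (set T)) : Prop :=
  (forall n, (1 <= n)%N -> sigma_algebra setT (F n) /\ F n `<=` measurable) /\
  (forall m n, (1 <= m)%N -> (m <= n)%N -> F m `<=` F n).

Definition measurable_wrt (G : set (set T)) (Y : T -> R) : Prop :=
  forall B : set R, measurable B -> G (Y @^-1` B).

(* Z is a version of E[Y | G] *)
Definition is_cond_exp (G : set (set T)) (Y Z : T -> R) : Prop :=
  [/\ measurable_wrt G Z,
      P.-integrable setT (EFin \o Z) &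
      forall A, G A ->
        (\int[P]_(w in A) (Z w)%:E = \int[P]_(w in A) (Y w)%:E)%E].

Definition martingale (F : nat -> set (set T)) (M : nat -> T -> R) : Prop :=
  [/\ filtration F,
      forall n, (1 <= n)%N -> measurable_wrt (F n) (M n),
      forall n, (1 <= n)%N -> P.-integrable setT (EFin \o M n) &
      forall n, (1 <= n)%N -> is_cond_exp (F n) (M n.+1) (M n)].

Definition nonnegative_martingale (F : nat -> set (set T)) (M : nat -> T -> R)
    : Prop :=
  martingale F M /\ forall n w, (1 <= n)%N -> 0 <= M n w.

End martingale.

Definition scale_invariant {R : realType} (n : nat) (f : n.-tuple R -> R)
    : Prop :=
  measurable_fun setT f /\
  forall (x : n.-tuple R) (l : R), 0 < l ->
    f [tuple l * tnth x i | i < n] = f x.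

Section statistics.
Context {d : measure_display} {T : measurableType d} {R : realType}.
Context {P : probability T R}.
Variable X : nat -> {RV P >-> R}.

Definition sample (n : nat) (w : T) : n.-tuple R := [tuple X i w | i < n].

Definition scale_invariant_filtration (n : nat) : set (set T) :=
  <<s \bigcup_(f in [set f : n.-tuple R -> R | scale_invariant f])
        preimage_set_system setT (f \o sample n) measurable >>.

Definition Ssum (n : nat) (w : T) : R := \sum_(i < n) X i w.

Definition Vsum (n : nat) (w : T) : R := \sum_(i < n) X i w ^+ 2.

Definition mean (n : nat) (w : T) : R := Ssum n w / n%:R.

Definition mean_sq (n : nat) (w : T) : R := Vsum n w / n%:R.

(* For n >= 1 the base is 0 / 0 = 0 on the event Vsum n w = 0, and its
   denominator is positive off that event. *)
Definition Gproc (c : R) (n : nat) (w : T) : R :=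
  Num.sqrt (c ^+ 2 / (n%:R + c ^+ 2)) *
  ((n%:R + c ^+ 2) * Vsum n w /
     ((n%:R + c ^+ 2) * Vsum n w - Ssum n w ^+ 2)) `^ (n%:R / 2).

Definition radius (c alpha : R) (n : nat) (w : T) : \bar R :=
  let t := (alpha ^+ 2 * c ^+ 2 / (n%:R + c ^+ 2)) `^ (n%:R^-1) in
  let den := Num.max (t * (n%:R + c ^+ 2) - c ^+ 2) 0 in
  if den == 0 then +oo%E
  else (Num.sqrt ((n%:R + c ^+ 2) * (1 - t) / den *
                  (mean_sq n w - mean n w ^+ 2)))%:E.

(* [mean - radius, mean + radius]; all of R when the radius is +oo *)
Definition conf_interval (c alpha : R) (n : nat) (w : T) : set R :=
  [set m | (`|mean n w - m|%:E <= radius c alpha n w)%E].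

End statistics.

Section confidence_sequence.
Context {d : measure_display} {T : measurableType d} {R : realType}.

(* Measurability is demanded because the value of P on a set that is not
   measurable carries no meaning. *)
Definition covers (P : probability T R) (CI : nat -> T -> set R) (alpha mu : R)
    : Prop :=
  let E := [set w | forall n, (1 <= n)%N -> CI n w mu] in
  measurable E /\ ((1 - alpha)%:E <= P E)%E.

End confidence_sequence.

(* Main.v *)
(** Fix sigma and put b = 1/(2 sigma^2), k = n + c^2, W = V_n - S_n^2/k.  The
    process L_n = sqrt(c^2/k) exp(b (V_n - W)) is the likelihood ratio against
    N(0, sigma^2)^n of a Gaussian mixture over the mean, hence integrates
    correctly against every event of the first n observations.  On scale
    invariant events L_n and G_n = sqrt(c^2/k) (V_n/W)^(n/2) have the same
    integral: average over a multiplicative scale exp u with Lebesgue measure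
    du, exchange the integrals, and use that rescaling a centered Gaussian
    sample only changes its density by an explicit factor.  The martingale
    property of G_n follows, and Ville's inequality applied to the centered
    sample gives the confidence sequence, since G_n < 1/alpha forces the mean
    into the stated interval. *)

From HB Require Import structures.
Require Import Defs.
From mathcomp Require Import all_boot all_order all_algebra.
From mathcomp Require Import all_classical all_reals all_analysis.
From mathcomp Require Import measurable_realfun.
From mathcomp Require Import ring lra.
Import Order.TTheory GRing.Theory Num.Theory.
Import numFieldNormedType.Exports.
Local Open Scope classical_set_scope.
Local Open Scope ring_scope.

Set Implicit Arguments.
Unset Strict Implicit.
Unset Printing Implicit Defensive.

Definition image_measure {d d'} {T1 : measurableType d} {T2 : measurableType d'}
    {R : realType} (m : {measure set T1 -> \bar R}) (f : T1 -> T2)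
    (mf : measurable_fun setT f) : {measure set T2 -> \bar R} :=
  measure_function_pushforward__canonical__measure_function_Measure m mf.

(** * Integration against normal laws and affine change of variables *)

Section normal_integral.
Context {R : realType}.
Notation mu := (@lebesgue_measure R).

(** The Radon-Nikodym derivative and [normal_pdf] have the same integral over every measurable set,
    hence agree almost everywhere. *)
Lemma ge0_integral_normal_prob (m s : R) (f : R -> \bar R) :
  measurable_fun setT f -> (forall x, (0 <= f x)%E) ->
  (\int[normal_prob m s]_x f x = \int[mu]_x (f x * (normal_pdf m s x)%:E))%E.
Proof.
move=> mf f0.
have dom := @normal_prob_dominates R m s.
rewrite -(Radon_Nikodym_SigmaFinite.change_of_variables dom)//.
have mpdf : measurable_fun setT (fun x => (normal_pdf m s x)%:E).
  by apply/measurable_EFinP; exact: measurable_normal_pdf.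
have mRN : measurable_fun setT (Radon_Nikodym_SigmaFinite.f (normal_prob m s)
  mu).
  exact: measurable_int (Radon_Nikodym_SigmaFinite.f_integrable dom).
apply: ae_eq_integral => //; [exact: emeasurable_funM..|].
apply: ae_eqe_mul2l.
apply: integral_ae_eq => //;
  first exact: Radon_Nikodym_SigmaFinite.f_integrable.
by move=> E _ mE; rewrite -Radon_Nikodym_SigmaFinite.f_integral.
Qed.

Let affine (a b x : R) : measurableTypeR R := a * x + b.

Let measurable_affine a b : measurable_fun [set: measurableTypeR R] (affine a
  b).
Proof. exact: measurable_funD. Qed.

(** By uniqueness of Lebesgue measure, half-open intervals suffice. A negative slope swaps the ends
    of the preimage, which is then closed on the left. *)
Lemma lebesgue_measure_affine (a b : R) (A : set R) : a != 0 -> measurable A ->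
  mu A = (`|a|%:E * mu ((fun x => a * x + b)%R @^-1` A))%E.
Proof.
move=> a0 mA.
pose m' : {measure set (measurableTypeR R) -> \bar R} :=
  mscale (NngNum (normr_ge0 a)) (image_measure mu (measurable_affine a b)).
rewrite (@lebesgue_measure_unique R m')// => _ [[x y] _ <-].
rewrite /m' /= /mscale/= /pushforward/=.
have [a_gt0|a_le0] := ltP 0 a.
  have -> : affine a b @^-1` `]x, y] = `](x - b) / a, (y - b) / a]%classic.
    apply/seteqP; split => z /=; rewrite !in_itv/= /affine ltr_pdivrMr//.
      by rewrite ler_pdivlMr// ltrBlDr lerBrDr mulrC.
    by rewrite ler_pdivlMr// ltrBlDr lerBrDr mulrC.
  rewrite !lebesgue_measure_itv/= !lte_fin ltr_pM2r ?invr_gt0// ltrD2r.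
  case: ifPn => _; last by rewrite mule0.
  by rewrite -EFinB -EFinM; congr EFin; rewrite gtr0_norm//; field.
have a_lt0 : a < 0 by rewrite lt_neqAle a0.
have -> : affine a b @^-1` `]x, y] = `[(y - b) / a, (x - b) / a[%classic.
  apply/seteqP; split => z /=; rewrite !in_itv/= /affine ltr_ndivlMr//.
    by rewrite ler_ndivrMr// ltrBlDr lerBrDr mulrC andbC.
  by rewrite ler_ndivrMr// ltrBlDr lerBrDr mulrC andbC.
rewrite !lebesgue_measure_itv/= !lte_fin ltr_nM2r ?invr_lt0// ltrD2r.
case: ifPn => _; last by rewrite mule0.
by rewrite -EFinB -EFinM; congr EFin; rewrite ltr0_norm//; field.
Qed.

Lemma ge0_integral_affine (a b : R) (f : R -> \bar R) : a != 0 ->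
  measurable_fun setT f -> (forall x, (0 <= f x)%E) ->
  (\int[mu]_x f x = `|a|%:E * \int[mu]_x f (a * x + b)%R)%E.
Proof.
move=> a0 mf f0.
pose m' : {measure set (measurableTypeR R) -> \bar R} :=
  mscale (NngNum (normr_ge0 a)) (image_measure mu (measurable_affine a b)).
transitivity (\int[m']_x f x)%E.
  apply: eq_measure_integral => A mA _.
  exact: lebesgue_measure_affine.
rewrite ge0_integral_mscale//; congr (_ * _)%E.
by rewrite (ge0_integral_pushforward (measurable_affine a b)).
Qed.

End normal_integral.

(** * One-dimensional Gaussian identities *)

Section normal_identities.
Context {R : realType}.
Notation mu := (@lebesgue_measure R).
Variable s : R.
Hypothesis s0 : s != 0.
Let b : R := (s ^+ 2 *+ 2)^-1.

(** Substituting [t * x] for [x] gives the Jacobian [t]; the exponential is the ratio of the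
    densities at [t * x] and [x]. *)
Lemma ge0_integral_normal_scale (t : R) (f : R -> \bar R) : 0 < t ->
  measurable_fun setT f -> (forall x, (0 <= f x)%E) ->
  (\int[normal_prob 0 s]_x f x =
   \int[normal_prob 0 s]_x
      (f (t * x)%R * (t * expR (- b * (t ^+ 2 - 1) * x ^+ 2))%:E))%E.
Proof.
move=> t0 mf f0; have t_neq0 : t != 0 by rewrite gt_eqF.
have mft : measurable_fun setT (fun x => f (t * x)).
  by apply: measurableT_comp => //; exact: measurable_funM.
rewrite !ge0_integral_normal_prob//; last 2 first.
  apply: emeasurable_funM => //; apply/measurable_EFinP.
  apply: measurable_funM => //; apply: measurableT_comp => //.
  by apply: measurable_funM => //; exact: measurable_funX.
  by move=> x; rewrite mule_ge0// lee_fin mulr_ge0 ?expR_ge0// ltW.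
rewrite (@ge0_integral_affine R t 0)//; last 2 first.
  by apply: emeasurable_funM => //; apply/measurable_EFinP;
    exact: measurable_normal_pdf.
  by move=> x; rewrite mule_ge0// lee_fin normal_pdf_ge0.
rewrite gtr0_norm// -ge0_integralZl//; first last.
- by rewrite lee_fin ltW.
- by move=> x _; rewrite mule_ge0// lee_fin normal_pdf_ge0.
- apply: emeasurable_funM => //; first by under eq_fun do rewrite addr0.
  apply/measurable_EFinP; apply: measurableT_comp;
    first exact: measurable_normal_pdf.
  by apply: measurable_funD => //; exact: measurable_funM.
apply: eq_integral => x _.
rewrite addr0 muleCA -!muleA; congr (_ * _)%E.
rewrite -!EFinM; congr EFin.
rewrite !normal_pdfE// /normal_fun.
have -> : - (t * x - 0) ^+ 2 / (s ^+ 2 *+ 2) =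
    - b * (t ^+ 2 - 1) * x ^+ 2 + - (x - 0) ^+ 2 / (s ^+ 2 *+ 2).
  by rewrite /b; ring.
by rewrite expRD; ring.
Qed.

(** Completing the square makes the integrand times the density a multiple of the normal density
    with mean [y / k] and scale [s * r], where [r ^+ 2 = (k + 1) / k]. This is what makes the
    Gaussian mixture likelihood ratio a martingale. *)
Lemma integral_normal_expR_sqr (k y : R) : 0 < k ->
  (\int[normal_prob 0 s]_x (expR (b * ((y + x) ^+ 2 / (k + 1))))%:E =
   (Num.sqrt ((k + 1) / k) * expR (b * (y ^+ 2 / k)))%:E)%E.
Proof.
move=> k0; rewrite ge0_integral_normal_prob//; last first.
  by apply/measurable_EFinP/measurableT_comp => //;
    apply: measurable_funM => //;
    apply: measurable_funM => //; apply: measurable_funX;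
      exact: measurable_funD.
have k1 : 0 < k + 1 by rewrite addr_gt0.
have kk0 : 0 < (k + 1) / k by rewrite divr_gt0.
pose r := Num.sqrt ((k + 1) / k).
have r0 : 0 < r by rewrite sqrtr_gt0.
have r2 : r ^+ 2 = (k + 1) / k by rewrite sqr_sqrtr// ltW.
have sr0 : s * r != 0 by rewrite mulf_neq0// gt_eqF.
under eq_integral => x _.
  have -> : ((expR (b * ((y + x) ^+ 2 / (k + 1))))%:E * (normal_pdf 0 s x)%:E =
     (r * expR (b * (y ^+ 2 / k)))%:E * (normal_pdf (y / k) (s * r) x)%:E)%E.
    rewrite -!EFinM; congr EFin.
    rewrite !normal_pdfE// /normal_fun /normal_peak.
    have -> : Num.sqrt ((s * r) ^+ 2 * pi *+ 2) = r * Num.sqrt (s ^+ 2 * pi *+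
      2).
      have -> : (s * r) ^+ 2 * pi *+ 2 = r ^+ 2 * (s ^+ 2 * pi *+ 2) by ring.
      by rewrite sqrtrM ?sqr_ge0// sqrtr_sqr gtr0_norm.
    have E : b * ((y + x) ^+ 2 / (k + 1)) + - (x - 0) ^+ 2 / (s ^+ 2 *+ 2) =
        b * (y ^+ 2 / k) + - (x - y / k) ^+ 2 / ((s * r) ^+ 2 *+ 2).
      rewrite exprMn r2 /b; field.
      by rewrite s0 !gt_eqF.
    rewrite invfM mulrCA -expRD E expRD; field.
    by rewrite !gt_eqF// sqrtr_gt0 mulrn_wgt0// mulr_gt0 ?pi_gt0//
      exprn_even_gt0.
  over.
rewrite ge0_integralZl//=; last 3 first.
- apply/measurable_EFinP; exact: measurable_normal_pdf.
- by move=> x _; rewrite lee_fin normal_pdf_ge0.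
- by rewrite lee_fin mulr_ge0 ?expR_ge0// ltW.
by rewrite integral_normal_pdf mule1.
Qed.

End normal_identities.

(** The sides are indexed by [nat] and not ['I_n], so that one family serves tuples of every
    length. *)
Definition rectangle {R : realType} n (C : nat -> set R) : set (n.-tuple R) :=
  [set x | forall i : 'I_n, C i (tnth x i)].
Arguments rectangle {R} n C : rename.

(** * Rectangles generate the sigma-algebra on tuples *)

Section tuples.
Context {R : realType}.

Lemma measurable_rectangle n (C : nat -> set R) :
  (forall i, measurable (C i)) -> measurable (rectangle n C).
Proof.
move=> mC.
have -> : rectangle n C = \bigcap_(i in [set: 'I_n]) ((@tnth n R)^~ i @^-1` C
  i).
  by apply/seteqP; split => [x Cx i _|x Cx i]; [exact: Cx|exact: Cx].
apply: fin_bigcap_measurable => // i _.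
by rewrite -[X in measurable X]setTI; exact: measurable_tnth.
Qed.

Lemma measurable_tupleE n :
  @measurable _ (n.-tuple R) =
  <<s [set rectangle n C | C in [set C | forall i, measurable (C i)]] >>.
Proof.
apply/seteqP; split.
  apply: smallest_sub; first exact: smallest_sigma_algebra.
  rewrite -bigcup_seq => A [/= i _] [B mB <-].
  apply: sub_sigma_algebra.
  exists (fun j : nat => if j == i :> nat then B else setT).
    by move=> j /=; case: ifP.
  rewrite setTI; apply/seteqP; split => x /=.
    by move=> /(_ i); rewrite eqxx.
  by move=> Bx j; case: ifPn => // /eqP/val_inj ->.
apply: smallest_sub; first exact: sigma_algebra_measurable.
by move=> _ [C mC <-]; exact: measurable_rectangle.
Qed.

(** Rectangles are stable under intersection, generate the measurable sets and include the whole
    space, which has finite mass. *)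
Lemma tuple_measure_unique n (m1 m2 : {measure set (n.-tuple R) -> \bar R}) :
  (m1 setT < +oo)%E ->
  (forall C, (forall i, measurable (C i)) ->
     m1 (rectangle n C) = m2 (rectangle n C)) ->
  forall A, measurable A -> m1 A = m2 A.
Proof.
move=> m1T m12; have rT : rectangle n (fun=> [set: R]) = setT by apply/seteqP;
  split.
apply: (measure_unique [set rectangle n C | C in [set C | forall i, measurable
  (C i)]]
  (fun=> setT)) => //.
- exact: measurable_tupleE.
- move=> _ _ [C mC <-] [D mD <-]; exists (fun i => C i `&` D i).
    by move=> i; exact: measurableI.
  by apply/seteqP; split => [x CD|x [Cx Dx] i]; [split => i;
    have [] := CD i|split; [exact: Cx|exact: Dx]].
- by move=> _; exists (fun=> setT).
- by apply/seteqP; split => // x _; exists 0%N.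
- by move=> _ [C mC <-]; exact: m12.
Qed.

Lemma tnth_rcons n (x : n.-tuple R) (y : R) (i : 'I_n.+1) :
  tnth [tuple of rcons x y] i = if unlift ord_max i is Some j then tnth x j
    else y.
Proof.
rewrite (tnth_nth 0)/= nth_rcons size_tuple.
case: unliftP => [j ->|->]; last by rewrite /= ltnn eqxx.
by rewrite lift_max ltn_ord (tnth_nth 0).
Qed.

Lemma measurable_fun_rcons d (T : measurableType d) n (f : T -> n.-tuple R) (g
  : T -> R) :
  measurable_fun setT f -> measurable_fun setT g ->
  measurable_fun setT (fun z => [tuple of rcons (f z) (g z)]).
Proof.
move=> mf mg; apply/measurable_fun_tnthP => i.
rewrite (_ : _ \o _ = fun z => if unlift ord_max i is Some j then tnth (f z) j
  else g z).
  by case: unliftP => // j _; move/measurable_fun_tnthP : mf; exact.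
by apply/funext => z /=; rewrite tnth_rcons.
Qed.

End tuples.

(** * The law of an i.i.d. sample *)

Section sample_law.
Context {d : measure_display} {T : measurableType d} {R : realType}.
Context {P : probability T R}.
Variable X : nat -> {RV P >-> R}.

Lemma measurable_sample n : measurable_fun setT (sample X n).
Proof.
apply/measurable_fun_tnthP => i.
by rewrite (_ : _ \o _ = X i)//; apply/funext => w /=; rewrite tnth_mktuple.
Qed.

Variable Q : probability (measurableTypeR R) R.
Hypothesis iidX : iid_from X Q.

Lemma probability_sample_rectangle n (C : nat -> set R) :
  (forall i, measurable (C i)) ->
  P (sample X n @^-1` rectangle n C) = (\prod_(i < n) Q (C i))%E.
Proof.
move=> mC; have [indX lawX] := iidX.
have -> : sample X n @^-1` rectangle n C =
    \bigcap_(i in [set` [fset i in iota 0 n]%fset]) (X i @^-1` C i).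
  apply/seteqP; split => w /=.
    move=> Cw i /=; rewrite !inE/= mem_iota/= add0n => ni.
    by have := Cw (Ordinal ni); rewrite tnth_mktuple.
  move=> Cw i; rewrite tnth_mktuple; apply: Cw => /=.
  by rewrite !inE/= mem_iota/= add0n.
rewrite indX// (perm_big (iota 0 n)); last first.
  apply: uniq_perm; [exact: fset_uniq|exact: iota_uniq|].
  by move=> i; rewrite !inE.
rewrite -(big_mkord xpredT (fun i => Q (C i))) /index_iota subn0.
by apply: eq_bigr => i _; rewrite -(lawX i).
Qed.

(** The sample of size [n.+1] has the law of the sample of size [n] with an independent [Q] variable
    appended: the two laws agree on rectangles, and Tonelli splits the product. *)
Lemma ge0_integral_sampleS n (f : n.+1.-tuple R -> \bar R) :
  measurable_fun setT f -> (forall x, (0 <= f x)%E) ->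
  (\int[P]_w f (sample X n.+1 w) =
   \int[P]_w \int[Q]_x f [tuple of rcons (sample X n w) x])%E.
Proof.
move=> mf f0.
(* The first factor is [T] itself, so that the outer integral stays one over [P]. *)
pose h (z : T * measurableTypeR R) := [tuple of rcons (sample X n z.1) z.2].
have mh : measurable_fun setT h.
  by apply: measurable_fun_rcons => //; apply: measurableT_comp => //;
    exact: measurable_sample.
transitivity (\int[image_measure P (measurable_sample (n:=n.+1))]_x f x)%E.
  by rewrite (ge0_integral_pushforward (measurable_sample (n:=n.+1))).
transitivity (\int[image_measure (P \x Q)%E mh]_x f x)%E.
  apply: eq_measure_integral => A mA _.
  apply: tuple_measure_unique => //.
    by rewrite /= /pushforward preimage_setT probability_setT ltry.
  move=> C mC; rewrite /= /pushforward probability_sample_rectangle//.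
  have -> : h @^-1` rectangle n.+1 C = (sample X n @^-1` rectangle n C) `*` C n.
    apply/seteqP; split => -[w x] /=.
      move=> H; split => [i|].
        have := H (widen_ord (leqnSn n) i).
        rewrite /h/= tnth_rcons.
        case: unliftP => [j /(congr1 val)/=|/(congr1 val)/=].
          by rewrite -[bump n j]/(nat_of_ord (lift ord_max j)) lift_max =>
            /val_inj <-.
        by move=> E; move: (ltn_ord i); rewrite E ltnn.
      by have := H ord_max; rewrite /h tnth_rcons unlift_none.
    move=> [Hw Hx] i; rewrite /h tnth_rcons/=.
    by case: unliftP => [j ->|->] //; rewrite lift_max.
  have mS : measurable (sample X n @^-1` rectangle n C).
    rewrite -[X in measurable X]setTI; apply: measurable_sample => //.
    exact: measurable_rectangle.
  have mCn : measurable (C n : set (measurableTypeR R)) := mC n.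
  transitivity (P (sample X n @^-1` rectangle n C) * Q (C n))%E.
    by rewrite probability_sample_rectangle// big_ord_recr.
  exact/esym/(product_measure1E P Q mS mCn).
rewrite (ge0_integral_pushforward mh)//= fubini_tonelli1//.
exact: measurableT_comp.
Qed.

End sample_law.

(** * Sums and sums of squares of tuples *)

Section tuple_statistics.
Context {R : realType}.

Definition tscale n (t : R) (x : n.-tuple R) : n.-tuple R :=
  [tuple t * tnth x i | i < n].

Definition tsum n (x : n.-tuple R) : R := \sum_(i < n) tnth x i.

Definition tsumsq n (x : n.-tuple R) : R := \sum_(i < n) tnth x i ^+ 2.

Lemma measurable_tscale n (t : R) : measurable_fun setT (@tscale n t).
Proof.
apply/measurable_fun_tnthP => i.
rewrite (_ : _ \o _ = (fun x : n.-tuple R => t * tnth x i)).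
  by apply: measurable_funM => //; exact: measurable_tnth.
by apply/funext => x /=; rewrite tnth_mktuple.
Qed.

Lemma measurable_tsum n : measurable_fun setT (@tsum n).
Proof. by apply: measurable_sum => i; exact: measurable_tnth. Qed.

Lemma measurable_tsumsq n : measurable_fun setT (@tsumsq n).
Proof.
by apply: measurable_sum => i; apply: measurable_funX; exact: measurable_tnth.
Qed.

Lemma tsum_scale n t (x : n.-tuple R) : tsum (tscale t x) = t * tsum x.
Proof. by rewrite mulr_sumr; apply: eq_bigr => i _; rewrite tnth_mktuple. Qed.

Lemma tsumsq_scale n t (x : n.-tuple R) : tsumsq (tscale t x) = t ^+ 2 * tsumsq
  x.
Proof.
by rewrite mulr_sumr; apply: eq_bigr => i _; rewrite tnth_mktuple exprMn.
Qed.

Lemma big_rcons_tuple n (x : n.-tuple R) (y : R) (f : R -> R) :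
  \sum_(i < n.+1) f (tnth [tuple of rcons x y] i) =
  \sum_(i < n) f (tnth x i) + f y.
Proof.
rewrite big_ord_recr/= tnth_rcons unlift_none; congr (_ + _).
apply: eq_bigr => i _; congr f; rewrite tnth_rcons.
have -> : widen_ord (leqnSn n) i = lift ord_max i.
  by apply: ord_inj; rewrite lift_max.
by rewrite liftK.
Qed.

Lemma tsum_rcons n (x : n.-tuple R) y : tsum [tuple of rcons x y] = tsum x + y.
Proof. exact: (big_rcons_tuple x y id). Qed.

Lemma tsumsq_rcons n (x : n.-tuple R) y :
  tsumsq [tuple of rcons x y] = tsumsq x + y ^+ 2.
Proof. exact: (big_rcons_tuple x y (fun z => z ^+ 2)). Qed.

Lemma tscale_rcons n t (x : n.-tuple R) y :
  tscale t [tuple of rcons x y] = [tuple of rcons (tscale t x) (t * y)].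
Proof.
apply: eq_from_tnth => i; rewrite tnth_mktuple !tnth_rcons.
by case: unliftP => // j _; rewrite tnth_mktuple.
Qed.

Lemma tsumsq_ge0 n (x : n.-tuple R) : 0 <= tsumsq x.
Proof. by apply: sumr_ge0 => i _; exact: sqr_ge0. Qed.

(** Cauchy-Schwarz, from the nonnegative sum of squared deviations from the average [m]. *)
Lemma sqr_tsum_le n (x : n.-tuple R) : tsum x ^+ 2 <= n%:R * tsumsq x.
Proof.
case: n x => [|n] x; first by rewrite /tsum big_ord0 expr0n/= mul0r.
pose m := tsum x / n.+1%:R.
have : 0 <= \sum_(i < n.+1) (tnth x i - m) ^+ 2.
  by apply: sumr_ge0 => i _; exact: sqr_ge0.
have -> : \sum_(i < n.+1) (tnth x i - m) ^+ 2 =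
    \sum_(i < n.+1) (tnth x i ^+ 2 - (m *+ 2) * tnth x i + m ^+ 2).
  by apply: eq_bigr => i _; ring.
rewrite big_split/= sumrB -mulr_sumr -/(tsum x) -/(tsumsq x) sumr_const
  card_ord.
rewrite -[m ^+ 2 *+ _]mulr_natr.
have -> : tsumsq x - m *+ 2 * tsum x + m ^+ 2 * n.+1%:R =
    tsumsq x - tsum x ^+ 2 / n.+1%:R.
  by rewrite /m; field; rewrite -[1 + _]/(1 + n%:R) addrC natr1 pnatr_eq0.
by rewrite subr_ge0 ler_pdivrMr ?ltr0n// mulrC.
Qed.

End tuple_statistics.

(** * Rescaling a centered Gaussian sample *)

Section gaussian_scaling.
Context {d : measure_display} {T : measurableType d} {R : realType}.
Context {P : probability T R}.
Variables (X : nat -> {RV P >-> R}) (s : R).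
Hypothesis s0 : s != 0.
Hypothesis iidX : iid_from X (normal_prob 0 s).
Let b : R := (s ^+ 2 *+ 2)^-1.

(** Induction on the sample size, splitting off the last observation; the density factors multiply
    because [tsumsq] is additive. *)
Lemma ge0_integral_sample_scale n (t : R) (f : n.-tuple R -> \bar R) : 0 < t ->
  measurable_fun setT f -> (forall x, (0 <= f x)%E) ->
  (\int[P]_w f (sample X n w) =
   \int[P]_w (f (tscale t (sample X n w)) *
     (t ^+ n * expR (- b * (t ^+ 2 - 1) * tsumsq (sample X n w)))%:E))%E.
Proof.
move=> t0; elim: n f => [|n IH] f mf f0.
  apply: eq_integral => w _;
    rewrite /tsumsq big_ord0 mulr0 expR0 expr0 mulr1 mule1.
  by rewrite [tscale _ _]tuple0 [sample _ _ _]tuple0.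
pose g1 (x : R) := t * expR (- b * (t ^+ 2 - 1) * x ^+ 2).
pose g m (x : m.-tuple R) := t ^+ m * expR (- b * (t ^+ 2 - 1) * tsumsq x).
have g1_ge0 x : 0 <= g1 x by rewrite mulr_ge0 ?expR_ge0// ltW.
have g_ge0 m (x : m.-tuple R) : 0 <= g m x.
  by rewrite mulr_ge0 ?expR_ge0// exprn_ge0// ltW.
have mg1 : measurable_fun setT g1.
  apply: measurable_funM => //; apply: measurableT_comp => //.
  by apply: measurable_funM => //; exact: measurable_funX.
have mg m : measurable_fun setT (g m).
  apply: measurable_funM => //; apply: measurableT_comp => //.
  by apply: measurable_funM => //; exact: measurable_tsumsq.
rewrite (ge0_integral_sampleS iidX mf f0).
(* [F] integrates out the last coordinate after rescaling it; the induction hypothesis applied to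
   [F] rescales the others. *)
pose F (z : n.-tuple R) := (\int[normal_prob 0 s]_x
  (f [tuple of rcons z (t * x)%R] * (g1 x)%:E))%E.
have mF : measurable_fun setT F.
  apply: (@measurable_fun_fubini_tonelli_F _ _ (n.-tuple R) (measurableTypeR R)
    R
    (normal_prob 0 s) (fun zx => f [tuple of rcons zx.1 (t * zx.2)%R] * (g1
      zx.2)%:E)%E).
    apply: emeasurable_funM; last first.
      by apply/measurable_EFinP; exact: measurableT_comp.
    apply: measurableT_comp => //; apply: measurable_fun_rcons => //.
    exact: measurable_funM.
  by move=> x; rewrite mule_ge0 ?lee_fin.
have F0 z : (0 <= F z)%E.
  by apply: integral_ge0 => x _; rewrite mule_ge0 ?lee_fin.
transitivity (\int[P]_w F (sample X n w))%E.
  apply: eq_integral => w _.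
  rewrite (ge0_integral_normal_scale s0 t0)//.
  by apply: measurableT_comp => //; apply: measurable_fun_rcons.
rewrite IH//.
transitivity (\int[P]_w \int[normal_prob 0 s]_x
   (f (tscale t [tuple of rcons (sample X n w) x]) *
    (g n.+1 [tuple of rcons (sample X n w) x])%:E))%E; last first.
  rewrite -(@ge0_integral_sampleS _ _ _ _ _ (normal_prob 0 s) iidX _
    (fun x => f (tscale t x) * (g n.+1 x)%:E)%E)//.
    apply: emeasurable_funM; last by apply/measurable_EFinP; exact: mg.
    by apply: measurableT_comp => //; exact: measurable_tscale.
  by move=> x; rewrite mule_ge0 ?lee_fin.
apply: eq_integral => w _.
rewrite -ge0_integralZr//; last 3 first.
- apply: emeasurable_funM; last by apply/measurable_EFinP.
  apply: measurableT_comp => //; apply: measurable_fun_rcons => //.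
- by move=> x _; rewrite mule_ge0 ?lee_fin.
- by rewrite lee_fin; exact: g_ge0.
apply: eq_integral => x _.
rewrite tscale_rcons -muleA; congr (_ * _)%E; rewrite -EFinM; congr EFin.
rewrite /g1 /g tsumsq_rcons.
have -> : - b * (t ^+ 2 - 1) * (tsumsq (sample X n w) + x ^+ 2) =
    - b * (t ^+ 2 - 1) * tsumsq (sample X n w) + - b * (t ^+ 2 - 1) * x ^+ 2 by
        ring.
by rewrite expRD (exprS t n); ring.
Qed.

End gaussian_scaling.

(** The square makes the base of the power nonnegative, where the exponent -1 is the inverse; at a
    zero of [f] both sides are 0. *)
Lemma measurable_fun_inv d (T : measurableType d) (R : realType) (f : T -> R) :
  measurable_fun setT f -> measurable_fun setT (fun x => (f x)^-1).
Proof.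
move=> mf; rewrite (_ : (fun x => _) = (fun x => f x * (f x ^+ 2) `^ (-1))).
  apply: measurable_funM => //; apply: (measurableT_comp (measurable_powR _)).
  exact: measurable_funX.
apply/funext => x; rewrite powR_inv1 ?sqr_ge0//.
have [->|fx0] := eqVneq (f x) 0; first by rewrite mul0r invr0.
by rewrite expr2 invfM mulVKf.
Qed.

(** * Averaging over the scale *)

Section radial.
Context {d : measure_display} {T : measurableType d} {R : realType}.
Context {P : probability T R}.
Variables (X : nat -> {RV P >-> R}) (s : R).
Hypothesis s0 : s != 0.
Hypothesis iidX : iid_from X (normal_prob 0 s).
Notation mu := (@lebesgue_measure R).
Let b : R := (s ^+ 2 *+ 2)^-1.
Variable n : nat.
(** With v = exp(2u) this is a Gamma integrand: for n >= 1 its integral is Gamma(n/2) / (2 b^(n/2)).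
    The argument uses only that this constant is finite and nonzero. *)
Let phi (u : R) : R := expR (n%:R * u - b * expR (2 * u)).

Let mphi : measurable_fun setT phi.
Proof.
apply: measurableT_comp => //; apply: measurable_funB => //.
by apply: measurable_funM => //; apply: measurableT_comp => //;
  exact: measurable_funM.
Qed.

Let V (w : T) := tsumsq (sample X n w).

Let mV : measurable_fun setT V.
Proof. by apply: measurableT_comp;
  [exact: measurable_tsumsq|exact: measurable_sample]. Qed.

Section weights.
Variables (h W : n.-tuple R -> R).
Hypothesis mh : measurable_fun setT h.
Hypothesis h_ge0 : forall x, 0 <= h x.
Hypothesis h_scale : forall t x, 0 < t -> h (tscale t x) = h x.
(** The weight removes the zero sample, at which [W] is 0 as well and the logarithms of [V] and [W]
    are default values. *)
Hypothesis h_eq0 : forall x, tsumsq x = 0 -> h x = 0.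
Hypothesis mW : measurable_fun setT W.
Hypothesis W_scale : forall t x, 0 < t -> W (tscale t x) = t ^+ 2 * W x.
Hypothesis W_gt0 : forall x, 0 < tsumsq x -> 0 < W x.

(* Both sides are [E] of an integral over a multiplicative scale [exp u];
   exchanging the integrals and rescaling the sample by [exp (- u)] turns one
   into the other. *)
Lemma ge0_integral_radial (psi : R -> R) :
  measurable_fun setT psi -> (forall u, 0 <= psi u) ->
  (\int[mu]_u (psi u)%:E *
     \int[P]_w (h (sample X n w) * expR (b * (V w - W (sample X n w))))%:E =
   \int[mu]_u (phi u)%:E *
     \int[P]_w (h (sample X n w) * expR (b * V w) * psi (ln (V w) / 2) *
       expR (- (n%:R / 2) * ln (W (sample X n w))))%:E)%E.
Proof.
move=> mpsi psi_ge0.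
have mhX : measurable_fun setT (fun w => h (sample X n w)).
  by apply: measurableT_comp => //; exact: measurable_sample.
have mWX : measurable_fun setT (fun w => W (sample X n w)).
  by apply: measurableT_comp => //; exact: measurable_sample.
have mlnV : measurable_fun setT (fun w => ln (V w) / 2).
  by apply: measurable_funM => //; exact: measurableT_comp.
pose a w := h (sample X n w) * expR (b * (V w - W (sample X n w))).
have ma : measurable_fun setT a.
  apply: measurable_funM => //; apply: measurableT_comp => //.
  by apply: measurable_funM => //; exact: measurable_funB.
have a_ge0 w : 0 <= a w by rewrite mulr_ge0 ?expR_ge0.
pose c w := h (sample X n w) * expR (b * V w) * psi (ln (V w) / 2).
have mc : measurable_fun setT c.
  apply: measurable_funM; last exact: measurableT_comp.
  apply: measurable_funM => //; apply: measurableT_comp => //.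
  exact: measurable_funM.
have c_ge0 w : 0 <= c w by rewrite !mulr_ge0 ?expR_ge0.
pose e (w : T) (u : R) :=
  expR (- (n%:R * u) - b * expR (- (2 * u)) * W (sample X n w)).
(* Lebesgue measure is shift invariant, so [psi] may be shifted by ln(V)/2. Rescaling the sample by
   exp(-u) then cancels [u] in the argument of [psi], which leaves [B]. *)
pose A (z : T * measurableTypeR R) : \bar R :=
  (a z.1 * psi (z.2 + ln (V z.1) / 2))%:E.
pose B (z : T * measurableTypeR R) : \bar R := (c z.1 * e z.1 z.2)%:E.
have mA : measurable_fun setT A.
  apply/measurable_EFinP; apply: measurable_funM.
    exact: measurableT_comp.
  apply: measurableT_comp => //; apply: measurable_funD => //.
  exact: (measurableT_comp mlnV).
have A_ge0 z : (0 <= A z)%E by rewrite lee_fin mulr_ge0.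
have mB : measurable_fun setT B.
  apply/measurable_EFinP; apply: measurable_funM.
    exact: measurableT_comp.
  apply: measurableT_comp => //; apply: measurable_funB => //.
    by apply: measurableT_comp => //; exact: measurable_funM.
  apply: measurable_funM; last exact: (measurableT_comp mWX).
  apply: measurable_funM => //; apply: measurableT_comp => //.
  by apply: measurableT_comp => //; exact: measurable_funM.
have B_ge0 z : (0 <= B z)%E by rewrite lee_fin mulr_ge0 ?expR_ge0.
transitivity (\int[P]_w \int[mu]_u A (w, u))%E.
  rewrite -ge0_integralZl//; first last.
  - by apply: integral_ge0 => u _; rewrite lee_fin.
  - by move=> w _; rewrite lee_fin; exact: a_ge0.
  - by apply/measurable_EFinP.
  apply: eq_integral => w _; rewrite /A /=.
  rewrite (@ge0_integral_affine R 1 (ln (V w) / 2) (EFin \o psi) (oner_neq0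
    _))//;
    last by apply/measurable_EFinP.
  rewrite normr1 mul1e muleC -ge0_integralZl//; first last.
  - by rewrite lee_fin; exact: a_ge0.
  - by move=> u _; rewrite lee_fin.
  - apply/measurable_EFinP; apply: measurableT_comp => //.
    by apply: measurable_funD => //; exact: measurable_funM.
  by apply: eq_integral => u _; rewrite mul1r -EFinM.
have FA : (\int[P]_w \int[mu]_u A (w, u) = \int[mu]_u \int[P]_w A (w, u))%E.
  exact: (@fubini_tonelli _ _ T (measurableTypeR R) R P mu A).
rewrite FA.
transitivity (\int[mu]_u \int[P]_w B (w, u))%E.
  apply: eq_integral => u _.
  pose t := expR (- u).
  have t_gt0 : 0 < t by exact: expR_gt0.
  pose f (x : n.-tuple R) : \bar R :=
    (h x * expR (b * (tsumsq x - W x)) * psi (u + ln (tsumsq x) / 2))%:E.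
  transitivity (\int[P]_w f (sample X n w))%E; first by [].
  rewrite (@ge0_integral_sample_scale _ _ _ _ _ _ s0 iidX _ t)//; last 2 first.
  - apply/measurable_EFinP; apply: measurable_funM.
      apply: measurable_funM => //; apply: measurableT_comp => //.
      apply: measurable_funM => //; apply: measurable_funB => //.
      exact: measurable_tsumsq.
    apply: measurableT_comp => //; apply: measurable_funD => //.
    apply: measurable_funM => //; apply: measurableT_comp => //.
    exact: measurable_tsumsq.
  - by move=> x; rewrite lee_fin !mulr_ge0 ?expR_ge0.
  apply: eq_integral => w _; rewrite /f /B -EFinM; congr EFin => /=.
  rewrite h_scale// W_scale// tsumsq_scale -/b -/(V w) /c.
  have [V0|V0] := eqVneq (V w) 0.
    by rewrite h_eq0// !mul0r.
  have Vgt0 : 0 < V w by rewrite lt_neqAle eq_sym V0 tsumsq_ge0.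
  have -> : u + ln (t ^+ 2 * V w) / 2 = ln (V w) / 2.
    rewrite lnM ?posrE ?exprn_gt0// lnXn// expRK; lra.
  have -> : t ^+ n = expR (- (n%:R * u)) by rewrite -expRM_natl mulrN.
  have t2 : t ^+ 2 = expR (- (2 * u)) by rewrite -expRM_natl mulrN.
  rewrite /e -t2; set x := sample X n w.
  have E : expR (b * (t ^+ 2 * V w - t ^+ 2 * W x)) *
      (expR (- (n%:R * u)) * expR (- b * (t ^+ 2 - 1) * V w)) =
      expR (b * V w) * expR (- (n%:R * u) - b * t ^+ 2 * W x).
    by rewrite -!expRD; congr expR; ring.
  transitivity (h x * psi (ln (V w) / 2) *
    (expR (b * V w) * expR (- (n%:R * u) - b * t ^+ 2 * W x))); last by ring.
  by rewrite -E; ring.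
have FB : (\int[P]_w \int[mu]_u B (w, u) = \int[mu]_u \int[P]_w B (w, u))%E.
  exact: (@fubini_tonelli _ _ T (measurableTypeR R) R P mu B).
rewrite -FB.
have K_ge0 : (0 <= \int[mu]_u (phi u)%:E)%E.
  by apply: integral_ge0 => u _; rewrite lee_fin expR_ge0.
rewrite -ge0_integralZl//; first last.
- by move=> w _; rewrite lee_fin mulr_ge0 ?expR_ge0//; exact: c_ge0.
- apply/measurable_EFinP; apply: measurable_funM => //.
  apply: measurableT_comp => //; apply: measurable_funM => //.
  exact: measurableT_comp.
apply: eq_integral => w _; rewrite /fubini_F /B /= -/(c w).
have [V0|V0] := eqVneq (V w) 0.
  have -> : c w = 0 by rewrite /c h_eq0// !mul0r.
  rewrite mul0r mule0; under eq_integral do rewrite mul0r.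
  by rewrite integral0.
have Wgt0 : 0 < W (sample X n w).
  by apply: W_gt0; rewrite lt_neqAle eq_sym V0 tsumsq_ge0.
(* The substitution of -u + ln(W)/2 for u turns [phi u] into W^(n/2) times [e w u]. *)
have N1 : - 1 != 0 :> R by rewrite oppr_eq0 oner_neq0.
have mEphi : measurable_fun setT (EFin \o phi) by apply/measurable_EFinP.
have Ephi_ge0 u : (0 <= (EFin \o phi) u)%E by rewrite lee_fin expR_ge0.
rewrite (ge0_integral_affine (ln (W (sample X n w)) / 2) N1 mEphi Ephi_ge0).
rewrite normrN1 mul1e muleC -ge0_integralZl//; first last.
- by rewrite lee_fin mulr_ge0 ?expR_ge0//; exact: c_ge0.
- apply/measurable_EFinP; apply: measurableT_comp => //.
  by apply: measurable_funD => //; exact: measurable_funM.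
apply: eq_integral => u _; rewrite -EFinM -[in RHS]mulrA; congr (_ * _)%:E.
rewrite /phi /e -expRD; congr expR.
have -> : expR (2 * (-1 * u + ln (W (sample X n w)) / 2)) =
    expR (- (2 * u)) * W (sample X n w).
  by rewrite -[in RHS](lnK Wgt0) -expRD; congr expR; lra.
by field.
Qed.

End weights.

Hypothesis n_gt0 : (0 < n)%N.

Lemma measurable_tsumsq_sample_eq0 : measurable [set w | V w = 0].
Proof.
rewrite (_ : [set w | _] = setT `&` V @^-1` [set 0]); first exact: mV.
by rewrite setTI.
Qed.

(** The event forces the first observation to be 0, and a law with a density gives no mass to a
    point. *)
Lemma tsumsq_sample_eq0 : P [set w | V w = 0] = 0%E.
Proof.
have mX0 : measurable (X 0%N @^-1` [set 0]).
  by rewrite -[X in measurable X]setTI; exact: measurable_funP.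
apply: (@subset_measure0 _ _ _ P _ (X 0%N @^-1` [set 0])) => //.
- exact: measurable_tsumsq_sample_eq0.
- move=> w /= Vw0.
  have /(_ (Ordinal n_gt0)) := psumr_eq0P (fun i _ => sqr_ge0 (tnth (sample X n
    w) i)) Vw0.
  by rewrite tnth_mktuple => /(_ erefl)/eqP; rewrite sqrf_eq0 => /eqP.
rewrite -[LHS]/(distribution P (X 0%N) [set 0]) (iidX.2 0%N)//.
have /null_content_dominatesP := @normal_prob_dominates R 0 s; apply => //.
exact: lebesgue_measure_set1.
Qed.

Let nz : set (n.-tuple R) := [set x | tsumsq x != 0].

Let mnz : measurable nz.
Proof.
rewrite (_ : nz = setT `&` (@tsumsq R n) @^-1` (~` [set 0])).
  by apply: measurable_tsumsq => //; exact: measurableC.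
by rewrite setTI; apply/seteqP; split => x /eqP.
Qed.

Let nz_scale t x : 0 < t -> \1_nz (tscale t x) = \1_nz x :> R.
Proof.
move=> t0; rewrite !indicE; congr ((_ : bool)%:R).
by apply/idP/idP; rewrite !inE/nz/= tsumsq_scale mulf_eq0 sqrf_eq0 (gt_eqF t0).
Qed.

Let nz_eq0 x : tsumsq x = 0 -> \1_nz x = 0 :> R.
Proof. by move=> x0; rewrite indicE memNset//= /nz/= x0 eqxx. Qed.

Let K : \bar R := (\int[mu]_u (phi u)%:E)%E.

(* Comparing [phi] with the indicator of [0, 1] in [ge0_integral_radial], for
   [W] the sum of squares itself, writes 1 as a product with factor [K]. *)
Let K_fin_neq0 : K \is a fin_num /\ K != 0%E.
Proof.
have m01 : measurable_fun setT (\1_`[0, 1] : R -> R) by exact: measurable_indic.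
have m1nz : measurable_fun setT (\1_nz : _ -> R) by exact: measurable_indic.
have := @ge0_integral_radial \1_nz (@tsumsq R n) m1nz
  (fun=> ler0n _ _) nz_scale nz_eq0 (@measurable_tsumsq R n)
  (fun t x _ => tsumsq_scale t x) (fun x => id) _ m01 (fun=> ler0n _ _).
have -> : (\int[mu]_u (\1_`[0%R, 1%R] u)%:E = 1 :> \bar R)%E.
  rewrite integral_indic//= setIT lebesgue_measure_itv/= lte01.
  by rewrite oppr0 adde0.
have -> : (\int[P]_w (\1_nz (sample X n w) * expR (b * (V w - tsumsq (sample X
  n w))))%:E = 1)%E.
  under eq_integral do rewrite subrr mulr0 expR0 mulr1.
  rewrite (_ : (fun w => _) = (EFin \o \1_(~` [set w | V w = 0]))); last first.
    apply/funext => w /=; rewrite !indicE; congr ((_ : bool)%:R%:E).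
    by apply/idP/idP; rewrite !inE /nz/= => /eqP.
  have mV0 := measurable_tsumsq_sample_eq0.
  rewrite integral_indic//; last exact: measurableC.
  rewrite setIT; apply: (etrans (probability_setC P mV0)).
  by rewrite tsumsq_sample_eq0 sube0.
rewrite mule1 -/K; set I := (\int[P]_w _)%E => KI.
have I0 : (0 <= I)%E by apply: integral_ge0 => w _;
  rewrite lee_fin !mulr_ge0 ?expR_ge0.
have K0 : (0 <= K)%E by apply: integral_ge0 => w _; rewrite lee_fin expR_ge0.
(* Here 1 = K * I with I >= 0. An infinite K would make the product 0 or infinite, and K = 0 would
   make it 0. *)
split.
  rewrite ge0_fin_numE// ltey; apply/eqP => Koo; move: KI; rewrite Koo.
  move: I0; rewrite le_eqVlt => /predU1P[<-|I0].
    by rewrite mule0 => /eqP; rewrite onee_eq0.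
  by rewrite gt0_mulye.
by apply/eqP => K00; move: KI; rewrite K00 mul0e => /eqP; rewrite onee_eq0.
Qed.

(** Take [psi] to be [phi] in [ge0_integral_radial]. As [phi (ln V / 2)] equals V^(n/2) exp(-bV),
    the exponentials cancel on the right, and the common factor [K] is divided out. *)
Lemma ge0_integral_scale_likelihood (h W : n.-tuple R -> R) :
  measurable_fun setT h -> (forall x, 0 <= h x) ->
  (forall t x, 0 < t -> h (tscale t x) = h x) ->
  measurable_fun setT W ->
  (forall t x, 0 < t -> W (tscale t x) = t ^+ 2 * W x) ->
  (forall x, 0 < tsumsq x -> 0 < W x) ->
  (\int[P]_w (h (sample X n w) * expR (b * (V w - W (sample X n w))))%:E =
   \int[P]_w (h (sample X n w) *
     (V w / W (sample X n w)) `^ (n%:R / 2))%:E)%E.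
Proof.
move=> mh h0 hs mW Ws Wp.
(* Cutting the weight off on the null event V = 0 changes neither integral. *)
pose h' x := h x * \1_nz x.
have [Kfin Kneq0] := K_fin_neq0.
have mh' : measurable_fun setT h' by apply: measurable_funM => //;
  exact: measurable_indic.
have h'0 x : 0 <= h' x by rewrite mulr_ge0.
have h's t x : 0 < t -> h' (tscale t x) = h' x.
  by move=> t0; rewrite /h' hs// nz_scale.
have h'_eq0 x : tsumsq x = 0 -> h' x = 0.
  by move=> x0; rewrite /h' nz_eq0// mulr0.
have mhX : measurable_fun setT (fun w => h (sample X n w)).
  by apply: measurableT_comp => //; exact: measurable_sample.
have mh'X : measurable_fun setT (fun w => h' (sample X n w)).
  by apply: measurableT_comp => //; exact: measurable_sample.
have mWX : measurable_fun setT (fun w => W (sample X n w)).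
  by apply: measurableT_comp => //; exact: measurable_sample.
have aeh (g : T -> R) : measurable_fun setT g -> (forall w, 0 <= g w) ->
    (\int[P]_w (h (sample X n w) * g w)%:E = \int[P]_w (h' (sample X n w) * g
      w)%:E)%E.
  move=> mg g0; apply: ge0_ae_eq_integral => //.
  - by apply/measurable_EFinP; exact: measurable_funM.
  - by apply/measurable_EFinP; exact: measurable_funM.
  - by move=> w _; rewrite lee_fin mulr_ge0.
  - by move=> w _; rewrite lee_fin mulr_ge0.
  - exists [set w | V w = 0]; split.
    + exact: measurable_tsumsq_sample_eq0.
    + exact: tsumsq_sample_eq0.
    + move=> w /= /not_implyP[_ hw]; apply: contra_notP hw => /eqP Vw.
      by rewrite /h' indicE mem_set ?mulr1.
rewrite aeh; last 2 first.
- apply: measurableT_comp => //; apply: measurable_funM => //.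
  exact: measurable_funB.
- by move=> w; exact: expR_ge0.
rewrite [RHS]aeh; last 2 first.
- apply: (measurableT_comp (measurable_powR _)); apply: measurable_funM => //.
  exact: measurable_fun_inv.
- by move=> w; exact: powR_ge0.
have := @ge0_integral_radial h' W mh' h'0 h's h'_eq0 mW Ws Wp phi mphi
  (fun=> expR_ge0 _).
rewrite -/K -(fineK Kfin) => /(congr1 (fun z => (fine K)^-1%:E * z)%E).
rewrite !muleA -!EFinM mulVf ?fine_eq0// !mul1e => ->.
apply: eq_integral => w _; congr EFin.
have [V0|V0] := eqVneq (V w) 0; first by rewrite h'_eq0// !mul0r.
have Vgt0 : 0 < V w by rewrite lt_neqAle eq_sym V0 tsumsq_ge0.
have Wgt0 : 0 < W (sample X n w) by exact: Wp.
rewrite /powR mulf_eq0 invr_eq0 (gt_eqF Vgt0) (gt_eqF Wgt0)/=.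
rewrite lnM ?posrE ?invr_gt0// lnV ?posrE//.
rewrite -!mulrA; congr (_ * _); rewrite /phi.
have -> : 2 * (ln (V w) / 2) = ln (V w) by lra.
by rewrite (lnK Vgt0) -!expRD; congr (_ * expR _); field.
Qed.
End radial.

(** * Structure of the scale invariant filtration *)

Section scale_invariant_filtration.
Context {d : measure_display} {T : measurableType d} {R : realType}.
Context {P : probability T R}.
Variable X : nat -> {RV P >-> R}.

Definition scale_invariant_set n (B : set (n.-tuple R)) :=
  measurable B /\ forall t x, 0 < t -> B (tscale t x) <-> B x.

(** Preimages of scale invariant measurable sets form a sigma-algebra that contains the
    generators. *)
Lemma scale_invariant_filtrationP n A : scale_invariant_filtration X n A ->
  exists2 B, scale_invariant_set B & A = sample X n @^-1` B.
Proof.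
move: A; apply: smallest_sub.
  split.
  - by exists set0 => //; rewrite preimage_set0.
  - move=> _ [B [mB sB] ->]; exists (~` B); last by rewrite setTD preimage_setC.
    split; first exact: measurableC.
    by move=> t x t0; split => Bx; apply: contra_not Bx => /(sB _ _ t0).
  - move=> F HF; have [B HB] := choice (fun i => let: ex_intro2 B h1 h2 := HF i
      in
      ex_intro (fun B => scale_invariant_set B /\ F i = sample X n @^-1` B) B
        (conj h1 h2)).
    exists (\bigcup_i B i).
      split; first by apply: bigcup_measurable => i _; have [[]] := HB i.
      move=> t x t0; split => -[i _ Bi]; exists i => //;
        by have [[_ /(_ t x t0) [? ?]] _] := HB i; auto.
    by rewrite preimage_bigcup; apply: eq_bigcupr => i _; have [] := HB i.
move=> A [f [mf sf]] [Y mY <-].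
exists (f @^-1` Y); last by rewrite setTI.
split; first by rewrite -[X in measurable X]setTI; exact: mf.
by move=> t x t0; rewrite /preimage/= /tscale sf.
Qed.

Definition ttake m n (mn : (m <= n)%N) (x : n.-tuple R) : m.-tuple R :=
  [tuple tnth x (widen_ord mn i) | i < m].

Lemma measurable_ttake m n (mn : (m <= n)%N) : measurable_fun setT (ttake mn).
Proof.
apply/measurable_fun_tnthP => i.
rewrite (_ : _ \o _ = (fun x : n.-tuple R => tnth x (widen_ord mn i))).
  exact: measurable_tnth.
by apply/funext => x /=; rewrite tnth_mktuple.
Qed.

Lemma ttake_scale m n (mn : (m <= n)%N) t x :
  ttake mn (tscale t x) = tscale t (ttake mn x).
Proof. by apply: eq_from_tnth => i; rewrite !tnth_mktuple. Qed.

Lemma ttake_sample m n (mn : (m <= n)%N) w : ttake mn (sample X n w) = sample X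
  m w.
Proof. by apply: eq_from_tnth => i; rewrite !tnth_mktuple. Qed.

Lemma ttake_rcons n (x : n.-tuple R) y : ttake (leqnSn n) [tuple of rcons x y]
  = x.
Proof.
apply: eq_from_tnth => i; rewrite tnth_mktuple tnth_rcons.
have -> : widen_ord (leqnSn n) i = lift ord_max i.
  by apply: ord_inj; rewrite lift_max.
by rewrite liftK.
Qed.

(** A scale invariant function of the first [m] coordinates, composed with truncation, is one of [n]
    coordinates. *)
Lemma scale_invariant_filtration_le m n : (m <= n)%N ->
  scale_invariant_filtration X m `<=` scale_invariant_filtration X n.
Proof.
move=> mn; apply: smallest_sub; first exact: smallest_sigma_algebra.
move=> A [f [mf sf]] [Y mY <-]; apply: sub_sigma_algebra.
exists (f \o ttake mn).
  split; first by apply: measurableT_comp => //; exact: measurable_ttake.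
  by move=> x l l0 /=; rewrite -[X in ttake _ X]/(tscale l x) ttake_scale;
    exact: sf.
exists Y => //; congr (_ `&` _); apply/seteqP; split => w /=;
  rewrite ttake_sample//.
Qed.

Lemma filtration_scale_invariant : filtration (scale_invariant_filtration X).
Proof.
split=> [n _|m n _]; last exact: scale_invariant_filtration_le.
split; first exact: smallest_sigma_algebra.
move=> _ /scale_invariant_filtrationP [B [mB _] ->].
by rewrite -[X in measurable X]setTI; exact: measurable_sample.
Qed.

End scale_invariant_filtration.

(** * The martingale property of [Gproc] *)

Section t_martingale.
Context {d : measure_display} {T : measurableType d} {R : realType}.
Context {P : probability T R}.
Variables (X : nat -> {RV P >-> R}) (c : R).
Hypothesis c_gt0 : 0 < c.

Let k n : R := n%:R + c ^+ 2.

Let k_gt0 n : 0 < k n.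
Proof. by rewrite ltr_wpDl// exprn_gt0. Qed.

(** The minimum over m of the sum of the (x_i - m)^2 plus c^2 m^2, attained at m = S/k. *)
Let W n (x : n.-tuple R) : R := tsumsq x - tsum x ^+ 2 / k n.

Definition Gstat n (x : n.-tuple R) : R :=
  Num.sqrt (c ^+ 2 / k n) * (tsumsq x / W x) `^ (n%:R / 2).

Let mW n : measurable_fun setT (@W n).
Proof.
apply: measurable_funB; first exact: measurable_tsumsq.
by apply: measurable_funM => //; apply: measurable_funX; exact: measurable_tsum.
Qed.

Let W_scale n t (x : n.-tuple R) : W (tscale t x) = t ^+ 2 * W x.
Proof. by rewrite /W tsum_scale tsumsq_scale; ring. Qed.

Let W_gt0 n (x : n.-tuple R) : 0 < tsumsq x -> 0 < W x.
Proof.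
move=> V0; rewrite subr_gt0 ltr_pdivrMr//.
rewrite (le_lt_trans (sqr_tsum_le x))// mulrC ltr_pM2l//.
by rewrite ltrDl exprn_gt0.
Qed.

Lemma GprocE n w : Gproc X c n w = Gstat (sample X n w).
Proof.
rewrite /Gproc /Gstat -/(k n); congr (_ * _ `^ _).
have -> : Vsum X n w = tsumsq (sample X n w).
  by apply: eq_bigr => i _; rewrite tnth_mktuple.
have -> : Ssum X n w = tsum (sample X n w).
  by apply: eq_bigr => i _; rewrite tnth_mktuple.
set V := tsumsq _; set S := tsum _.
have -> : k n * V - S ^+ 2 = k n * (V - S ^+ 2 / k n).
  by rewrite mulrBr mulrCA mulfV ?mulr1// gt_eqF.
by rewrite invfM mulrACA divff ?mul1r// gt_eqF.
Qed.

Lemma Gstat_ge0 n (x : n.-tuple R) : 0 <= Gstat x.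
Proof. by rewrite mulr_ge0 ?sqrtr_ge0 ?powR_ge0. Qed.

Lemma measurable_Gstat n : measurable_fun setT (@Gstat n).
Proof.
apply: measurable_funM => //; apply: (measurableT_comp (measurable_powR _)).
apply: measurable_funM; first exact: measurable_tsumsq.
exact: (measurable_fun_inv (@mW n)).
Qed.

Lemma Gstat_scale n t (x : n.-tuple R) : 0 < t -> Gstat (tscale t x) = Gstat x.
Proof.
move=> t0; rewrite /Gstat W_scale tsumsq_scale invfM mulrACA divff ?mul1r//.
by rewrite expf_neq0// gt_eqF.
Qed.

Lemma measurable_Gproc n : measurable_fun setT (Gproc X c n).
Proof.
rewrite (funext (GprocE n)); apply: measurableT_comp.
  exact: measurable_Gstat.
exact: measurable_sample.
Qed.

Lemma measurable_wrt_Gproc n :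
  measurable_wrt (scale_invariant_filtration X n) (Gproc X c n).
Proof.
move=> B mB; apply: sub_sigma_algebra; exists (@Gstat n).
  split; first exact: measurable_Gstat.
  by move=> x l l0; exact: Gstat_scale.
by exists B => //; rewrite setTI (funext (GprocE n)).
Qed.

Variable s : R.
Hypothesis s0 : s != 0.
Hypothesis iidX : iid_from X (normal_prob 0 s).
Let b : R := (s ^+ 2 *+ 2)^-1.

(* Density at [x], relative to [N(0, s^2)^n], of the mixture of the laws
   [N(s m, s^2)^n] over [m ~ N(0, c^-2)]. *)
Let L n (x : n.-tuple R) : R :=
  Num.sqrt (c ^+ 2 / k n) * expR (b * (tsum x ^+ 2 / k n)).

Let L_ge0 n (x : n.-tuple R) : 0 <= L x.
Proof. by rewrite mulr_ge0 ?expR_ge0 ?sqrtr_ge0. Qed.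

Let mL n : measurable_fun setT (@L n).
Proof.
apply: measurable_funM => //; apply: measurableT_comp => //.
apply: measurable_funM => //; apply: measurable_funM => //.
by apply: measurable_funX; exact: measurable_tsum.
Qed.

Let integral_indic_sample n (B : set (n.-tuple R)) (f : T -> R) :
  (\int[P]_(w in sample X n @^-1` B) (f w)%:E =
   \int[P]_w (\1_B (sample X n w) * f w)%:E)%E.
Proof.
rewrite integral_mkcond; apply: eq_integral => w _.
rewrite patchE indicE; case: ifPn => [|wB].
  by rewrite inE => wB; rewrite mem_set// mul1r.
by rewrite memNset ?mul0r//; move: wB; rewrite notin_setE.
Qed.

(** Apply [ge0_integral_scale_likelihood] to a multiple of the indicator of a scale invariant set: V
    - W = S^2/k turns the exponential into that of [L]. *)
Let integral_Gstat n A : (0 < n)%N -> scale_invariant_filtration X n A ->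
  (\int[P]_(w in A) (Gproc X c n w)%:E = \int[P]_(w in A) (L (sample X n
    w))%:E)%E.
Proof.
move=> n0 /scale_invariant_filtrationP[B [mB sB] ->].
rewrite !integral_indic_sample.
pose C := Num.sqrt (c ^+ 2 / k n).
have C0 : 0 <= C by exact: sqrtr_ge0.
have mh : measurable_fun setT (fun x : n.-tuple R => C * \1_B x).
  by apply: measurable_funM => //; exact: measurable_indic.
have h0 (x : n.-tuple R) : 0 <= C * \1_B x by rewrite mulr_ge0.
have hs t x : 0 < t -> C * \1_B (tscale t x) = C * \1_B x.
  move=> t0; congr (_ * _); rewrite !indicE; congr ((_ : bool)%:R).
  by apply/idP/idP; rewrite !inE => /(sB _ _ t0).
have := ge0_integral_scale_likelihood s0 iidX n0 mh h0 hs (@mW n)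
  (fun t x _ => W_scale t x) (@W_gt0 n).
rewrite -/b => H.
transitivity (\int[P]_w (C * \1_B (sample X n w) *
   (tsumsq (sample X n w) / W (sample X n w)) `^ (n%:R / 2))%:E)%E.
  by apply: eq_integral => w _; rewrite GprocE /Gstat -/C mulrCA mulrA.
rewrite -H; apply: eq_integral => w _; congr EFin.
by rewrite /L -/C mulrCA mulrA /W subKr.
Qed.

(** Integrating out the last observation yields the factor sqrt((k+1)/k), which changes the
    normalisation sqrt(c^2/(k+1)) into sqrt(c^2/k). *)
Let integral_L n A : scale_invariant_filtration X n A ->
  (\int[P]_(w in A) (L (sample X n.+1 w))%:E = \int[P]_(w in A) (L (sample X n
    w))%:E)%E.
Proof.
move=> /scale_invariant_filtrationP[B [mB sB] ->];
  rewrite !integral_indic_sample.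
pose f (y : n.+1.-tuple R) : \bar R := (\1_B (ttake (leqnSn n) y) * L y)%:E.
transitivity (\int[P]_w f (sample X n.+1 w))%E.
  by apply: eq_integral => w _; rewrite /f ttake_sample.
rewrite (ge0_integral_sampleS iidX); last 2 first.
- apply/measurable_EFinP; apply: measurable_funM; last exact: mL.
  apply: (measurableT_comp (measurable_indic mB)) => //.
  exact: measurable_ttake.
- by move=> y; rewrite lee_fin mulr_ge0.
apply: eq_integral => w _; rewrite /f.
pose y := tsum (sample X n w).
pose C := \1_B (sample X n w) * Num.sqrt (c ^+ 2 / k n.+1).
have kS : k n.+1 = k n + 1 by rewrite /k -natr1 addrAC.
transitivity (\int[normal_prob 0 s]_x
   (C%:E * (expR (b * ((y + x) ^+ 2 / (k n + 1))))%:E))%E.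
  apply: eq_integral => x _; rewrite ttake_rcons /L tsum_rcons -EFinM.
  by rewrite -kS /C -[in RHS]mulrA.
rewrite ge0_integralZl//; last 2 first.
- apply/measurable_EFinP/measurableT_comp => //; apply: measurable_funM => //.
  by apply: measurable_funM => //; apply: measurable_funX;
    exact: measurable_funD.
- by rewrite lee_fin mulr_ge0 ?sqrtr_ge0.
rewrite (integral_normal_expR_sqr s0 _ (k_gt0 n)) -EFinM /C /L kS; congr EFin.
rewrite -!mulrA; congr (_ * _); rewrite !mulrA; congr (_ * _).
rewrite -sqrtrM; last by rewrite divr_ge0 ?sqr_ge0// ltW// addr_gt0.
by rewrite mulrA divfK// gt_eqF// addr_gt0.
Qed.

(** Pass from [Gproc] to [L] at time [n.+1], step back to time [n] with [L], and return to [Gproc].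
    The first passage uses that [A] also belongs to the later sigma-algebra. *)
Lemma integral_GprocS n A : (0 < n)%N -> scale_invariant_filtration X n A ->
  (\int[P]_(w in A) (Gproc X c n.+1 w)%:E = \int[P]_(w in A) (Gproc X c n
    w)%:E)%E.
Proof.
move=> n0 FA; rewrite integral_Gstat// ?integral_L// ?integral_Gstat//.
exact: (scale_invariant_filtration_le _ FA).
Qed.

(** For one observation V = S^2, so V/W = k/c^2 and the square roots cancel. On the null event V = 0
    the division convention gives the value 0 instead. *)
Lemma Gproc1_ae : {ae P, forall w, Gproc X c 1 w = 1}.
Proof.
exists [set w | tsumsq (sample X 1 w) = 0]; split.
- exact: measurable_tsumsq_sample_eq0.
- exact: (@tsumsq_sample_eq0 _ _ _ _ _ _ iidX 1).
move=> w /= G1; apply: contra_notP G1 => /eqP V0.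
rewrite GprocE /Gstat /W.
have tE : tsumsq (sample X 1 w) = tsum (sample X 1 w) ^+ 2.
  by rewrite /tsumsq /tsum !big_ord1.
rewrite tE in V0 *; set z := tsum _ ^+ 2 in V0 *.
have k0 : k 1 != 0 by rewrite gt_eqF.
have -> : z / (z - z / k 1) = k 1 / c ^+ 2.
  have c0 : c != 0 by rewrite gt_eqF.
  have k1c : k 1 - 1 = c ^+ 2 by rewrite /k addrC addKr.
  rewrite -k1c; field.
  have -> : z * k 1 - z = z * c ^+ 2 by rewrite -k1c; ring.
  by rewrite k1c k0 expf_neq0// mulf_neq0// expf_neq0.
rewrite div1r powR12_sqrt ?divr_ge0 ?sqr_ge0 ?ltW//.
rewrite -sqrtrM ?divr_ge0 ?sqr_ge0 ?ltW//.
by rewrite mulrA divfK// divff ?sqrtr1// expf_neq0// gt_eqF.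
Qed.

Lemma integral_Gproc n : (0 < n)%N -> (\int[P]_w (Gproc X c n w)%:E = 1)%E.
Proof.
case: n => // n _; elim: n => [|n IH].
  rewrite (ae_eq_integral (cst 1%E))//.
  - by rewrite integral_cst// mul1e; exact: probability_setT.
  - apply/measurable_EFinP; exact: measurable_Gproc.
  - by apply: filterS Gproc1_ae => w /= ->.
rewrite integral_GprocS//.
have [/(_ n.+1 isT)[[F0 FC _] _] _] := filtration_scale_invariant X.
by have := FC _ F0; rewrite setD0.
Qed.

Lemma integrable_Gproc n : (0 < n)%N -> P.-integrable setT (EFin \o Gproc X c
  n).
Proof.
move=> n0; apply/integrableP; split.
  by apply/measurable_EFinP; exact: measurable_Gproc.
under eq_integral do rewrite /= ger0_norm ?GprocE ?Gstat_ge0// -GprocE.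
by rewrite integral_Gproc// ltry.
Qed.

Lemma Gproc_nonnegative_martingale :
  nonnegative_martingale P (scale_invariant_filtration X) (Gproc X c).
Proof.
split; last by move=> n w _; rewrite GprocE Gstat_ge0.
split.
- exact: filtration_scale_invariant.
- by move=> n _; exact: measurable_wrt_Gproc.
- exact: integrable_Gproc.
- move=> n n0; split.
  + exact: measurable_wrt_Gproc.
  + exact: integrable_Gproc.
  + by move=> A FA; rewrite integral_GprocS.
Qed.

End t_martingale.

(** * Ville's inequality *)

Section ville.
Context {d : measure_display} {T : measurableType d} {R : realType}.
Variables (P : probability T R) (F : nat -> set (set T)) (M : nat -> T -> R).
Hypothesis martM : nonnegative_martingale P F M.

Let integral_le m n A : (1 <= m)%N -> (m <= n)%N -> F m A ->
  (\int[P]_(w in A) (M n w)%:E = \int[P]_(w in A) (M m w)%:E)%E.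
Proof.
move=> m1 mn FA; have [[[_ Fle] _ _ ceM] _] := martM.
rewrite -(subnKC mn); elim: (n - m)%N => [|i IH]; first by rewrite addn0.
have m1i : (1 <= m + i)%N by rewrite (leq_trans m1)// leq_addr.
rewrite addnS; have [_ _ <-] := ceM _ m1i; first exact: IH.
by apply: Fle FA => //; exact: leq_addr.
Qed.

(** Split the event by the first time the process reaches [a]. On each piece [D i] the integral of
    [M i.+1] is at least [a] times the mass and equals that of [M N.+1]; the pieces are disjoint, so
    the sum is at most the mean of [M N.+1], which is that of [M 1]. *)
Lemma ville_inequality (a : R) : 0 < a ->
  (P (\bigcup_n [set w | a <= M n.+1 w]%R) <=
   a^-1%:E * \int[P]_w (M 1%N w)%:E)%E.
Proof.
move=> a0; have [[[salgF Fle] mM iM _] M0] := martM.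
pose B n := [set w | a <= M n.+1 w]; pose D := seqDU B.
have FB n : F n.+1 (B n).
  have -> : B n = M n.+1 @^-1` `[a, +oo[.
    by apply/seteqP; split => w /=; rewrite in_itv/= andbT.
  by apply: mM => //; exact: measurable_itv.
have FD n : F n.+1 (D n).
  have [[F0 FC FU] _] := salgF n.+1 isT.
  (* A complement of a countable union, the two operations of [sigma_algebra]; indices from [n] on
     are filled with the complement of [B n]. *)
  have -> : D n = setT `\` \bigcup_k (if (k < n)%N then B k else setT `\` B n).
    rewrite /D /seqDU -bigcup_mkord; apply/seteqP; split => w /=.
      move=> [Bn Bk]; split => // -[k _]; case: ifPn => [kn Bkw|_ []//].
      by apply: Bk; exists k.
    move=> [_ nU]; split.
      apply: contrapT => nBn; apply: nU; exists n => //.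
      by rewrite ltnn.
    by move=> [k /= kn Bk]; apply: nU; exists k => //; rewrite kn.
  apply: (FC); apply: (FU) => k; case: ifPn => kn; last exact: FC.
  by apply: (Fle k.+1) => //; exact: ltnW.
have mD n : measurable (D n) by have [_] := salgF n.+1 isT; apply.
have tD : trivIset setT D by exact: trivIset_seqDU.
have mM' n : measurable_fun setT (EFin \o M n.+1).
  exact: measurable_int (iM n.+1 isT).
rewrite -/(\bigcup_n B n) (seqDU_bigcup_eq B) measure_semi_bigcup//;
  last exact: bigcupT_measurable.
apply: lime_le; first exact: is_cvg_nneseries.
apply: nearW => N.
rewrite lee_pdivlMl//.
have DM i : (a%:E * P (D i) <= \int[P]_(w in D i) (M i.+1 w)%:E)%E.
  rewrite -integral_cst//; apply: ge0_le_integral => //.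
  - by move=> w _; rewrite lee_fin ltW.
  - by apply: measurable_funTS; exact: mM'.
  - by move=> w Dw; rewrite lee_fin; exact: (@subset_seqDU _ B i w Dw).
rewrite ge0_sume_distrr//.
apply: (@le_trans _ _ (\sum_(0 <= i < N) \int[P]_(w in D i) (M N.+1 w)%:E)%E).
  rewrite big_nat [leRHS]big_nat; apply: lee_sum => i /andP[_ iN].
  by rewrite (@integral_le i.+1 N.+1)//; [exact: DM|exact: ltnW].
rewrite -ge0_integral_bigsetU//=; first last.
- by move=> w _; rewrite lee_fin M0.
- by apply: measurable_funTS; exact: mM'.
- by apply: sub_trivIset tD.
- exact: iota_uniq.
rewrite -(@integral_le 1%N N.+1 setT)//; last first.
  by have [[F0 FC _] _] := salgF 1%N isT; have := FC _ F0; rewrite setD0.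
apply: ge0_subset_integral => //.
- by apply: bigsetU_measurable.
- exact: mM'.
- by move=> w _; rewrite lee_fin M0.
Qed.
End ville.

(** * Reduction to mean zero *)

Section centering.
Context {d : measure_display} {T : measurableType d} {R : realType}.
Context {P : probability T R}.
Variables (X : nat -> {RV P >-> R}) (m : R).

Let measurable_center i : measurable_fun setT (fun w => X i w - m).
Proof. exact: measurable_funB. Qed.

Definition centered i : {RV P >-> R} :=
  HB.pack (fun w => X i w - m)
    (isMeasurableFun.Build _ _ _ _ _ (measurable_center i)).

Lemma normal_prob_center (s : R) (B : set R) : s != 0 -> measurable B ->
  normal_prob m s ((fun x => x - m) @^-1` B) = normal_prob 0 s B.
Proof.
move=> s0 mB; rewrite /normal_prob integral_mkcond [RHS]integral_mkcond.
have mf : measurable_fun setT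
    ((fun x => (normal_pdf m s x)%:E) \_ ((fun x => x - m) @^-1` B)).
  apply/(measurable_restrictT _ _).1.
    by rewrite -[X in measurable X]setTI; apply: measurable_funB.
  by apply: measurable_funTS; apply/measurable_EFinP;
    exact: measurable_normal_pdf.
rewrite (ge0_integral_affine m (oner_neq0 R) mf); last first.
  by move=> x; rewrite patchE; case: ifP => //; rewrite lee_fin normal_pdf_ge0.
rewrite normr1 mul1e; apply: eq_integral => x _; rewrite mul1r !patchE.
have -> : (x + m \in (fun x => x - m) @^-1` B) = (x \in B).
  by apply/idP/idP; rewrite !inE/= addrK.
have -> // : normal_pdf m s (x + m) = normal_pdf 0 s x.
by rewrite !normal_pdfE// /normal_fun addrK subr0.
Qed.

Lemma iid_centered (s : R) : s != 0 ->
  iid_from X (normal_prob m s) -> iid_from centered (normal_prob 0 s).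
Proof.
move=> s0 [indX lawX].
have mcB (B : set R) : measurable B -> measurable ((fun x => x - m) @^-1` B).
  by move=> mB; rewrite -[X in measurable X]setTI; apply: measurable_funB.
split.
  move=> J B mB; have := indX J (fun i => (fun x => x - m) @^-1` B i).
  by apply => i; exact: mcB.
move=> i B mB; rewrite -(normal_prob_center s0 mB) -(lawX i)//; exact: mcB.
Qed.

End centering.

(** * From a bound on [Gproc] to the confidence interval *)

Section radius.
Context {d : measure_display} {T : measurableType d} {R : realType}.
Context {P : probability T R}.
Variables (X : nat -> {RV P >-> R}) (c alpha : R).
Hypothesis c_gt0 : 0 < c.
Hypothesis alpha_gt0 : 0 < alpha.

(** Since t^n = alpha^2 c^2 / k, the square of [alpha * g] is (t r)^n. Hence t r < 1, which is
    linear in S^2. *)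
Lemma sqr_le_of_Gratio (n : nat) (V S k : R) (t := (alpha ^+ 2 * c ^+ 2 / k) `^
  n%:R^-1) :
  (0 < n)%N -> 0 < k -> 0 < k * V - S ^+ 2 ->
  Num.sqrt (c ^+ 2 / k) * (k * V / (k * V - S ^+ 2)) `^ (n%:R / 2) < alpha^-1 ->
  S ^+ 2 <= k * (1 - t) * V.
Proof.
move=> n0 k0 D0; set r := k * V / _; set g := Num.sqrt _ * _ => galpha.
have n_neq0 : n%:R != 0 :> R by rewrite pnatr_eq0 -lt0n.
have r0 : 0 <= r.
  by rewrite divr_ge0// ltW// (lt_le_trans D0)// lerBlDr lerDl sqr_ge0.
have q0 : 0 <= alpha ^+ 2 * c ^+ 2 / k by rewrite divr_ge0 ?mulr_ge0 ?sqr_ge0//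
  ltW.
have tn : t ^+ n = alpha ^+ 2 * c ^+ 2 / k.
  by rewrite -powR_mulrn ?powR_ge0// /t -powRrM mulVf// powRr1.
have g0 : 0 <= g by rewrite mulr_ge0 ?sqrtr_ge0 ?powR_ge0.
have ag1 : alpha * g < 1 by rewrite mulrC -ltr_pdivlMr// div1r.
have : (alpha * g) ^+ 2 < 1 by rewrite expr_lt1// mulr_ge0// ltW.
have -> : (alpha * g) ^+ 2 = (t * r) ^+ n.
  rewrite /g exprMn exprMn sqr_sqrtr; last by rewrite divr_ge0 ?sqr_ge0// ltW.
  rewrite -[(r `^ _) ^+ 2]powR_mulrn ?powR_ge0// -powRrM divfK ?pnatr_eq0//.
  by rewrite powR_mulrn// [in RHS]exprMn tn !mulrA.
rewrite expr_lt1 -?lt0n// => [tr1|]; last by rewrite mulr_ge0 ?powR_ge0.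
have : t * r * (k * V - S ^+ 2) < k * V - S ^+ 2 by rewrite gtr_pMl.
rewrite -mulrA /r divfK ?gt_eqF//; lra.
Qed.

(** Centering turns the error of the mean into S/n and leaves the empirical variance unchanged, so
    the bound on S^2 in terms of V can be rewritten in observable terms. *)
Lemma conf_interval_of_Gproc m n w : (0 < n)%N ->
  Gproc (centered X m) c n w < alpha^-1 -> conf_interval X c alpha n w m.
Proof.
move=> n0; rewrite /Gproc /conf_interval /Defs.radius/=.
set S := Ssum (centered X m) n w; set V := Vsum (centered X m) n w.
set k := n%:R + c ^+ 2; set t := (_ / k) `^ _.
have n_gt0 : 0 < n%:R :> R by rewrite ltr0n.
have n_neq0 : n%:R != 0 :> R by rewrite gt_eqF.
have c2 : 0 < c ^+ 2 by rewrite exprn_gt0.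
have k_gt0 : 0 < k by rewrite addr_gt0.
have SX : Ssum X n w = S + n%:R * m.
  transitivity (\sum_(i < n) (centered X m i w + m)).
    by apply: eq_bigr => i _; rewrite subrK.
  by rewrite big_split/= sumr_const card_ord mulr_natl.
have VX : Vsum X n w = V + 2 * m * S + n%:R * m ^+ 2.
  transitivity (\sum_(i < n)
      (centered X m i w ^+ 2 + 2 * m * centered X m i w + m ^+ 2)).
    by apply: eq_bigr => i _; rewrite /=; ring.
  by rewrite !big_split/= -mulr_sumr sumr_const card_ord -[m ^+ 2 *+
    n]mulr_natl.
have meanE : mean X n w - m = S / n%:R by rewrite /mean SX; field.
have varE : mean_sq X n w - mean X n w ^+ 2 = V / n%:R - (S / n%:R) ^+ 2.
  by rewrite /mean_sq /mean SX VX; field.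
rewrite meanE varE => HG.
have SV : S ^+ 2 <= n%:R * V.
  have := sqr_tsum_le (sample (centered X m) n w).
  rewrite (_ : tsum _ = S); last by apply: eq_bigr => i _; rewrite tnth_mktuple.
  by rewrite (_ : tsumsq _ = V)//; apply: eq_bigr => i _; rewrite tnth_mktuple.
have V0 : 0 <= V by apply: sumr_ge0 => i _; exact: sqr_ge0.
have [den_le0|den_gt0] := leP (t * k - c ^+ 2) 0.
  by rewrite eqxx leey.
rewrite (gt_eqF den_gt0) lee_fin.
have Sle : S ^+ 2 <= k * (1 - t) * V.
  (* If V = 0, then [SV] already gives the bound; otherwise S^2 <= n V < k V makes the denominator
     of the ratio positive. *)
  have [V_eq0|V_neq0] := eqVneq V 0.
    by move: SV; rewrite V_eq0 !mulr0.
  apply: (sqr_le_of_Gratio n0 k_gt0) => //.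
  rewrite subr_gt0 (le_lt_trans SV)// ltr_pM2r; first by rewrite ltrDl.
  by rewrite lt_neqAle eq_sym V_neq0.
rewrite -sqrtr_sqr ler_wsqrtr// mulrAC ler_pdivlMr// -subr_ge0.
(* The coefficients of (S/n)^2 add up to k - c^2 = n. *)
have -> : k * (1 - t) * (V / n%:R - (S / n%:R) ^+ 2) -
    (S / n%:R) ^+ 2 * (t * k - c ^+ 2) = (k * (1 - t) * V - S ^+ 2) / n%:R.
  by rewrite /k; field.
by rewrite divr_ge0 ?ler0n// subr_ge0.
Qed.

(** Whether the radius is infinite does not depend on [w], so the two cases are treated
    separately. *)
Lemma measurable_conf_interval m n : measurable [set w | conf_interval X c
  alpha n w m].
Proof.
have mS : measurable_fun setT (mean X n).
  by apply: measurable_funM => //; apply: measurable_sum => i.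
have mV : measurable_fun setT (mean_sq X n).
  by apply: measurable_funM => //; apply: measurable_sum => i;
    exact: measurable_funX.
rewrite /conf_interval /Defs.radius/=; set t := _ `^ _; set den := Num.max _ _.
have [_|_] := eqVneq den 0.
  by rewrite (_ : [set w | _] = setT)//; apply/seteqP; split => w //= _;
    rewrite leey.
pose A := (n%:R + c ^+ 2) * (1 - t) / den.
have mle : measurable_fun setT
    (fun w => `|mean X n w - m| <= Num.sqrt (A * (mean_sq X n w - mean X n w ^+
      2))).
  apply: measurable_fun_ler.
    by apply: measurableT_comp => //; exact: measurable_funB.
  apply: (measurableT_comp (continuous_measurable_fun (@sqrt_continuous R))).
  by apply: measurable_funM => //; apply: measurable_funB => //;
    exact: measurable_funX.
rewrite (_ : [set w | _] = setT `&` (fun w => `|mean X n w - m| <=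
    Num.sqrt (A * (mean_sq X n w - mean X n w ^+ 2))) @^-1` [set true]).
  exact: mle.
by rewrite setTI; apply/seteqP; split => w /=; rewrite lee_fin.
Qed.

End radius.

Theorem theorem4p9 (R : realType) (c : R) (hc : 0 < c) :
  (forall (d : measure_display) (T : measurableType d) (P : probability T R)
      (X : nat -> {RV P >-> R}) (sigma : R),
    0 < sigma -> iid_from X (normal_prob 0 sigma) ->
    [/\ nonnegative_martingale P (scale_invariant_filtration X) (Gproc X c),
        forall n, (1 <= n)%N -> ('E_P[Gproc X c n] = 1)%E &
        {ae P, forall w, Gproc X c 1 w = 1}])
  /\
  (forall alpha : R, 0 < alpha < 1 ->
   forall (d : measure_display) (T : measurableType d) (P : probability T R)
      (X : nat -> {RV P >-> R}) (mu sigma : R),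
    0 < sigma -> iid_from X (normal_prob mu sigma) ->
    covers P (conf_interval X c alpha) alpha mu).
Proof.
split=> [d T P X s s_gt0 iidX|alpha /andP[alpha_gt0 _] d T P X m s s_gt0 iidX].
  have s0 : s != 0 by rewrite gt_eqF.
  split.
  - exact: Gproc_nonnegative_martingale s0 iidX.
  - by move=> n n0; rewrite unlock; exact: (integral_Gproc hc s0 iidX n0).
  - exact: Gproc1_ae iidX.
have s0 : s != 0 by rewrite gt_eqF.
have iidY := iid_centered s0 iidX.
set E := [set w | forall n, (1 <= n)%N -> conf_interval X c alpha n w m].
have mE : measurable E.
  rewrite (_ : E = \bigcap_(n in [set n | (1 <= n)%N])
      [set w | conf_interval X c alpha n w m]); last first.
    by apply/seteqP; split.
  by apply: bigcap_measurable => [|n _];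
    [exists 1%N|exact: measurable_conf_interval].
split=> //; rewrite -/E.
have mG n : measurable [set w | alpha^-1 <= Gproc (centered X m) c n.+1 w].
  rewrite (_ : [set w | _] = setT `&` Gproc (centered X m) c n.+1 @^-1`
    `[alpha^-1, +oo[).
    by apply: measurable_Gproc => //; exact: measurable_itv.
  by rewrite setTI; apply/seteqP; split => w /=; rewrite in_itv/= andbT.
(* Off [E] some interval misses the mean, so [Gproc] of the centered sample reaches 1/alpha; its
   expectation at time 1 is 1. *)
have PEC : (P (~` E) <= alpha%:E)%E.
  have := ville_inequality (Gproc_nonnegative_martingale hc s0 iidY)
    (a := alpha^-1).
  rewrite invr_gt0 => /(_ alpha_gt0);
    rewrite invrK (integral_Gproc hc s0 iidY)// mule1.
  apply: le_trans; apply: le_measure; rewrite ?inE.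
  - exact: measurableC.
  - exact: bigcupT_measurable.
  - move=> w /existsNP[[|n] /not_implyP[// _ nCI]]; exists n => //=.
    rewrite leNgt; apply/negP => Gw; apply: nCI.
    exact: conf_interval_of_Gproc.
have := probability_setC P mE; move: PEC => /[swap] ->.
by rewrite EFinB leeBlDr ?fin_num_measure// leeBlDl ?fin_num_measure//.
Qed.
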